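(* Let $(W,G,\mathcal{J})$ be a generalized Hermitian space with equivalent quadruple $(\gamma,\psi,J_+,J_-)$, and let $V\subseteq W$ be a subspace. Then $V$ is a generalized Hermitian subspace of $W$ if and only if $J_+(V)=V$ and $J_-(V)=V$.
   Context: For a finite-dimensional real vector space $W$ put $\mathbf{W}=W\oplus W^*$ with $g((X,\alpha),(Y,\mu))=\frac12(\alpha(Y)+\mu(X))$; the superscript $c$ denotes complexification, and tensors and maps are extended complex-linearly. A linear generalized complex structure on $W$ is $\mathcal{J}\in\mathrm{End}(\mathbf W)$, $\mathcal{J}^2=-\mathrm{Id}$, $g$-skew-symmetric. A generalized (Euclidean) metric on $W$ is a Euclidean metric $G$ on $\mathbf W$ for which there is a decomposition $\mathbf{W}=W_+\oplus W_-$ with $W_\pm$ maximal $g$-positive, respectively $g$-negative, $W_+\perp_g W_-$, $W_+\perp_G W_-$, $G|_{W_\pm}=\pm2g|_{W_\pm}$; $H$ is the endomorphism equal to $\pm\mathrm{Id}$ on $W_\pm$ (so $G(\cdot,\cdot)=2g(H\cdot,\cdot)$). One has $W_\pm=\{(X,\flat_{\psi\pm\gamma}X): X\in W\}$ for a unique pair $(\gamma,\psi)$, $\gamma$ a positive definite metric and $\psi\in\wedge^2W^*$, where $\flat_\theta X=\theta(X,\cdot)$; $\tau_\pm X=(X,\flat_{\psi\pm\gamma}X)$. A generalized Hermitian structure $(G,\mathcal{J})$ on $W$ is a generalized metric $G$ and a generalized complex structure $\mathcal J$ commuting with $H$; then $\mathcal{J}'=H\circ\mathcal{J}$ is a second generalized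 complex structure. With $L$ the $i$-eigenspace of $\mathcal J$, put $L_\pm=L\cap W_\pm^c$. The structure is equivalent to the decomposition $\mathbf{W}^c=L_+\oplus L_-\oplus\bar L_+\oplus\bar L_-$ such that (i) $L_+\oplus L_-$ and $L_+\oplus\bar L_-$ are Dirac (maximal $g$-isotropic) subspaces (the $i$-eigenspaces of $\mathcal J$, $\mathcal J'$), (ii) $L_+\oplus\bar L_+$ and $L_-\oplus\bar L_-$ are the complexifications of the $\pm1$-eigenspaces of the product structure $H$ of a generalized metric. The projections to $W$ of $\mathcal J|_{W_\pm}$ are the $\gamma$-compatible complex structures $J_\pm=pr_W\circ\mathcal{J}\circ\tau_\pm$ on $W$; generalized Hermitian structures correspond bijectively to quadruples $(\gamma,\psi,J_+,J_-)$. For a linear map $f_*:V\to W$, the pullback of $U\subseteq\mathbf{W}^c$ is $\overleftarrow f^*U=\{(X,f^*\eta):(f_*X,\eta)\in U\}$. A subspace $\iota_*:V\subseteq W$ is a generalized Hermitian subspace if the spaces $\overleftarrow\iota^*L_\pm\subseteq\mathbf V^c$ define a generalized Hermitian structure on $V$, i.e. $\mathbf{V}^c=\overleftarrow\iota^*L_+\oplus\overleftarrow\iota^*L_-\oplus\overline{\overleftarrow\iota^*L_+}\oplus\overline{\overleftarrow\iota^*L_-}$ and the analogues of (i), (ii) hold on $V$. *)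

(* Defs.v *)
From HB Require Import structures.
From mathcomp Require Import all_boot all_order all_algebra.
From mathcomp Require Import complex.

Set Implicit Arguments.
Unset Strict Implicit.
Unset Printing Implicit Defensive.

Import Order.TTheory GRing.Theory Num.Theory.

Local Open Scope ring_scope.
Local Open Scope complex_scope.

(* [Cplx x y] stands for x + iy. *)
Record cplx (U : Type) : Type := Cplx { cre : U; cim : U }.

Definition pair_of_cplx (U : Type) (z : cplx U) : U * U := (cre z, cim z).
Definition cplx_of_pair (U : Type) (p : U * U) : cplx U := Cplx p.1 p.2.
Lemma pair_of_cplxK (U : Type) : cancel (@pair_of_cplx U) (@cplx_of_pair U).
Proof. by case. Qed.

HB.instance Definition _ (U : eqType) :=
  Equality.copy (cplx U) (can_type (@pair_of_cplxK U)).
HB.instance Definition _ (U : choiceType) :=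
  Choice.copy (cplx U) (can_type (@pair_of_cplxK U)).

Section CplxZmodule.
Variable U : zmodType.
Implicit Types z : cplx U.

Definition cplx_zero : cplx U := Cplx 0 0.
Definition cplx_opp z : cplx U := Cplx (- cre z) (- cim z).
Definition cplx_add z1 z2 : cplx U := Cplx (cre z1 + cre z2) (cim z1 + cim z2).

Fact cplx_addA : associative cplx_add.
Proof. by move=> [? ?] [? ?] [? ?]; rewrite /cplx_add /= !addrA. Qed.
Fact cplx_addC : commutative cplx_add.
Proof. by move=> [a b] [c d]; rewrite /cplx_add /= [a + _]addrC [b + _]addrC. Qed.
Fact cplx_add0 : left_id cplx_zero cplx_add.
Proof. by move=> [? ?]; rewrite /cplx_add /= !add0r. Qed.
Fact cplx_addN : left_inverse cplx_zero cplx_opp cplx_add.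
Proof. by move=> [? ?]; rewrite /cplx_add /= !addNr. Qed.

HB.instance Definition _ :=
  GRing.isZmodule.Build (cplx U) cplx_addA cplx_addC cplx_add0 cplx_addN.

Lemma creD z1 z2 : cre (z1 + z2) = cre z1 + cre z2. Proof. by []. Qed.
Lemma cimD z1 z2 : cim (z1 + z2) = cim z1 + cim z2. Proof. by []. Qed.
End CplxZmodule.

Section CplxModule.
Variables (R : rcfType) (U : lmodType R).
Implicit Types (a : R[i]) (z : cplx U).

Definition cplx_scale a z : cplx U :=
  Cplx (complex.Re a *: cre z - complex.Im a *: cim z)
       (complex.Re a *: cim z + complex.Im a *: cre z).

Fact cplx_scaleA a b z : cplx_scale a (cplx_scale b z) = cplx_scale (a * b) z.
Proof.
case: a b z => [a a'] [b b'] [x y]; rewrite /cplx_scale /=; congr Cplx.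
  rewrite scalerBr scalerDr scalerBl scalerDl !scalerA !opprD.
  by rewrite [LHS](AC (2*2) ((1*4)*(2*3))).
rewrite scalerBr scalerDr scalerBl scalerDl !scalerA.
by rewrite [LHS](AC (2*2) ((1*4)*(2*3))).
Qed.
Fact cplx_scale1 : left_id 1 cplx_scale.
Proof.
by move=> [x y]; rewrite /cplx_scale /= !scale1r !scale0r subr0 addr0.
Qed.
Fact cplx_scaleDr : right_distributive cplx_scale +%R.
Proof.
move=> a z1 z2; rewrite /cplx_scale; congr Cplx => /=.
  by rewrite !scalerDr opprD addrACA.
by rewrite !scalerDr addrACA.
Qed.
Fact cplx_scaleDl z : {morph cplx_scale^~ z : a b / a + b}.
Proof.
move=> [a a'] [b b']; rewrite /cplx_scale; congr Cplx => /=.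
  by rewrite !scalerDl opprD addrACA.
by rewrite !scalerDl addrACA.
Qed.

HB.instance Definition _ := GRing.Zmodule_isLmodule.Build R[i] (cplx U)
  cplx_scaleA cplx_scale1 cplx_scaleDr cplx_scaleDl.

Lemma cplx_scaleE a z : a *: z =
  Cplx (complex.Re a *: cre z - complex.Im a *: cim z)
       (complex.Re a *: cim z + complex.Im a *: cre z).
Proof. by []. Qed.

Lemma cplxE z : z = Cplx (cre z) 0 + 'i *: Cplx (cim z) 0.
Proof.
case: z => x y; rewrite cplx_scaleE /=; congr Cplx;
  by rewrite /= ?scale0r ?scale1r ?scaler0 ?subrr ?addr0 ?add0r.
Qed.
End CplxModule.

Section CplxVector.
Import VectorInternalTheory.
Variables (R : rcfType) (U : vectType R).

Definition cplx2rV (z : cplx U) : 'rV[R[i]]_(dim U) :=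
  \row_j (v2r (cre z) 0 j +i* v2r (cim z) 0 j).
Definition rV2cplx (v : 'rV[R[i]]_(dim U)) : cplx U :=
  Cplx (r2v (\row_j complex.Re (v 0 j))) (r2v (\row_j complex.Im (v 0 j))).

Fact cplx_vect_iso : Vector.axiom (dim U) (cplx U).
Proof.
exists cplx2rV.
  move=> a z1 z2; apply/rowP=> j; rewrite !mxE /= !linearE !mxE /=.
  by case: a => a a'; rewrite [v2r (- _)]linearN mxE mulrN; simpc.
exists rV2cplx => [[x y]|v].
  congr Cplx; rewrite -[RHS]v2rK; congr r2v; apply/rowP=> j; by rewrite !mxE.
by apply/rowP=> j; rewrite !mxE /= !r2vK !mxE; case: (v 0 j).
Qed.

HB.instance Definition _ :=
  Lmodule_hasFinDim.Build R[i] (cplx U) cplx_vect_iso.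
End CplxVector.

Definition cext (R : rcfType) (U V : vectType R) (f : 'Hom(U, V)) :
    'Hom(cplx U, cplx V) :=
  linfun (fun z : cplx U => Cplx (f (cre z)) (f (cim z))).

Definition cbil (R : rcfType) (U : vectType R) (b : U -> U -> R)
    (z1 z2 : cplx U) : R[i] :=
  (b (cre z1) (cre z2) - b (cim z1) (cim z2))
    +i* (b (cre z1) (cim z2) + b (cim z1) (cre z2)).

(* A^c, as the image of the complexified inclusion of A in U *)
Definition cplxv (R : rcfType) (U : vectType R) (A : {vspace U}) :
    {vspace cplx U} :=
  limg (cext (linfun (vsval : subvs_of A -> U))).

Definition cconj (U : zmodType) (z : cplx U) : cplx U := Cplx (cre z) (- cim z).

(* Conjugation is antilinear, so the conjugate subspace is given by generators;
   see [memv_conjv]. *)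
Definition conjv (R : rcfType) (U : vectType R) (A : {vspace cplx U}) :
    {vspace cplx U} :=
  <<[seq cconj z | z <- vbasis A]>>%VS.

Lemma cextE (R : rcfType) (U V : vectType R) (f : 'Hom(U, V)) (z : cplx U) :
    cext f z = Cplx (f (cre z)) (f (cim z)).
Proof.
have lin : linear (fun z : cplx U => Cplx (f (cre z)) (f (cim z))).
  move=> a x y; rewrite creD cimD !cplx_scaleE /= !linearD /= linearN.
  by rewrite !linearZ.
pose g : {linear cplx U -> cplx V} := HB.pack
  (fun z : cplx U => Cplx (f (cre z)) (f (cim z)))
  (GRing.isLinear.Build R[i] (cplx U) (cplx V) _ _ lin).
exact: (lfunE g z).
Qed.

Section ComplexificationFacts.
Variables (R : rcfType) (U : vectType R).

Lemma memv_cplxv (A : {vspace U}) z :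
  (z \in cplxv A) = (cre z \in A) && (cim z \in A).
Proof.
apply/idP/andP => [/memv_imgP[w _ ->]|[zr zi]].
  by rewrite cextE !lfunE; split; apply: subvsP.
apply/memv_imgP; exists (Cplx (vsproj A (cre z)) (vsproj A (cim z))).
  exact: memvf.
by rewrite cextE !lfunE /= !vsprojK //; case: z zr zi.
Qed.

Lemma cconjK : involutive (@cconj U).
Proof. by case=> x y; rewrite /cconj /= opprK. Qed.

Lemma cconjD : {morph @cconj U : x y / x + y}.
Proof. by move=> x y; rewrite /cconj /= opprD. Qed.

Lemma cconjZ (a : R[i]) (z : cplx U) : cconj (a *: z) = a^* *: cconj z.
Proof.
case: a => a b; rewrite !cplx_scaleE /cconj /=; congr Cplx.
  by rewrite scaleNr scalerN opprK.
by rewrite opprD scalerN scaleNr.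
Qed.

Lemma memv_conjv (A : {vspace cplx U}) z : (z \in conjv A) = (cconj z \in A).
Proof.
have sumE (I : Type) (r : seq I) (F : I -> cplx U) :
  cconj (\sum_(i <- r) F i) = \sum_(i <- r) cconj (F i).
  apply: (big_morph _ cconjD); by rewrite /cconj /= oppr0.
apply/idP/idP => [|zA].
  rewrite /conjv -[map _ _]/(tval (map_tuple _ (vbasis A))) => /coord_span ->.
  rewrite sumE rpred_sum // => i _; rewrite cconjZ memvZ //.
  rewrite (nth_map 0) ?size_tuple // cconjK.
  by apply: vbasis_mem; rewrite mem_nth // size_tuple.
rewrite -[z]cconjK (coord_vbasis zA) sumE rpred_sum // => i _.
rewrite cconjZ memvZ // memv_span //; apply: map_f.
by rewrite mem_nth // size_tuple.
Qed.

End ComplexificationFacts.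

Notation leigenspace := passmx.leigenspace.

Lemma memv_leigenspace (K : fieldType) (T : vectType K) (f : 'End(T)) (a : K) x :
  (x \in leigenspace f a) = (f x == a *: x).
Proof.
by rewrite memv_ker add_lfunE opp_lfunE scale_lfunE id_lfunE subr_eq0.
Qed.

Definition dual (R : rcfType) (W : vectType R) : vectType R := 'Hom(W, R^o).

Definition big (R : rcfType) (W : vectType R) : vectType R :=
  (W * dual W)%type.

Definition gpair (R : rcfType) (W : vectType R) (x y : big W) : R :=
  2^-1 * (x.2 y.1 + y.2 x.1).

Section GeneralizedStructures.
Variables (R : rcfType) (W : vectType R).
Implicit Types (G : {dot big W for idfun}) (H J : 'End(big W)).
Implicit Types (A Wp Wm : {vspace big W}) (E Lp Lm : {vspace cplx (big W)}).

Definition generalized_complex J : Prop :=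
  (J \o J)%VF = - \1%VF /\ forall x y, gpair (J x) y = - gpair x (J y).

Definition g_positive A : Prop := forall x, x \in A -> x != 0 -> 0 < gpair x x.
Definition g_negative A : Prop := forall x, x \in A -> x != 0 -> gpair x x < 0.

Definition maximal_sub (K : fieldType) (T : vectType K)
    (P : {vspace T} -> Prop) (A : {vspace T}) : Prop :=
  P A /\ forall B : {vspace T}, P B -> (A <= B)%VS -> B = A.

Record metric_splitting G Wp Wm : Prop := MetricSplitting {
  splitting_sum : (Wp + Wm = fullv)%VS;
  splitting_direct : directv (Wp + Wm);
  splitting_pos : maximal_sub g_positive Wp;
  splitting_neg : maximal_sub g_negative Wm;
  splitting_g_orth : {in Wp & Wm, forall x y, gpair x y = 0};
  splitting_G_orth : {in Wp & Wm, forall x y, G x y = 0};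
  splitting_G_pos : {in Wp &, forall x y, G x y = 2 * gpair x y};
  splitting_G_neg : {in Wm &, forall x y, G x y = - (2 * gpair x y)} }.

(* G is a generalized metric and H is its product structure; W_+ and W_- are
   then the eigenspaces of H for 1 and -1. *)
Definition generalized_metric G H : Prop :=
  exists Wp Wm, [/\ metric_splitting G Wp Wm,
    {in Wp, forall x, H x = x} & {in Wm, forall x, H x = - x}].

Definition generalized_hermitian G H J : Prop :=
  [/\ generalized_metric G H, generalized_complex J & (J \o H = H \o J)%VF].

Definition Lplus H J : {vspace cplx (big W)} :=
  (leigenspace (cext J) 'i :&: cplxv (leigenspace H 1))%VS.
Definition Lminus H J : {vspace cplx (big W)} :=
  (leigenspace (cext J) 'i :&: cplxv (leigenspace H (-1)))%VS.

Definition isotropic E : Prop :=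
  {in E &, forall x y, cbil (@gpair R W) x y = 0}.

Definition dirac E : Prop := maximal_sub isotropic E.

Definition defines_generalized_hermitian Lp Lm : Prop :=
  [/\ (Lp + Lm + conjv Lp + conjv Lm = fullv)%VS,
      directv (Lp + Lm + conjv Lp + conjv Lm),
      dirac (Lp + Lm) /\ dirac (Lp + conjv Lm)
    & exists G H, [/\ generalized_metric G H,
        (Lp + conjv Lp = cplxv (leigenspace H 1))%VS
      & (Lm + conjv Lm = cplxv (leigenspace H (-1)))%VS]].

Definition flat (theta : W -> W -> R) (X : W) : dual W :=
  linfun (theta X : W -> R^o).

Lemma flatE (theta : W -> W -> R) X Y :
  scalar (theta X) -> flat theta X Y = theta X Y.
Proof.
move=> lin; pose t : {linear W -> R^o} := HB.pack (theta X : W -> R^o)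
  (GRing.isLinear.Build R W R^o _ (theta X) lin).
exact: (lfunE t Y).
Qed.

Definition tau (theta : W -> W -> R) (X : W) : big W := (X, flat theta X).

Lemma flat_psi_gammaE (gamma : {dot W for idfun}) (psi : {skew_symmetric W})
    X Y :
  flat (fun X Y => psi X Y + gamma X Y) X Y = psi X Y + gamma X Y /\
  flat (fun X Y => psi X Y - gamma X Y) X Y = psi X Y - gamma X Y.
Proof.
split; apply: flatE => a u v; rewrite !linearP /=.
  by rewrite mulrDr addrACA.
by rewrite mulrBr opprD addrACA.
Qed.

Definition equivalent_quadruple H J (gamma : {dot W for idfun})
    (psi : {skew_symmetric W}) (Jp Jm : 'End(W)) : Prop :=
  let taup := tau (fun X Y => psi X Y + gamma X Y) in
  let taum := tau (fun X Y => psi X Y - gamma X Y) in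
  [/\ forall x, x \in leigenspace H 1 <-> exists X, x = taup X,
      forall x, x \in leigenspace H (-1) <-> exists X, x = taum X,
      forall X, Jp X = (J (taup X)).1
    & forall X, Jm X = (J (taum X)).1].

End GeneralizedStructures.

Section Pullback.
Variables (R : rcfType) (V W : vectType R) (f : 'Hom(V, W)).

(* (X, eta) |-> (f X, eta) and (X, eta) |-> (X, f^* eta) on V + W^* *)
Definition push_fst : 'Hom((V * dual W)%type, big W) :=
  linfun (fun p : V * dual W => (f p.1, p.2) : big W).
Definition pull_snd : 'Hom((V * dual W)%type, big V) :=
  linfun (fun p : V * dual W => (p.1, (p.2 \o f)%VF) : big V).

Definition pullback (U : {vspace cplx (big W)}) : {vspace cplx (big V)} :=
  (cext pull_snd @: (cext push_fst @^-1: U))%VS.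

Lemma push_fstE p : push_fst p = (f p.1, p.2).
Proof.
have lin : linear (fun p : V * dual W => (f p.1, p.2) : big W).
  by move=> a x y; rewrite /= linearP.
pose g : {linear (V * dual W)%type -> big W} := HB.pack
  (fun p : V * dual W => (f p.1, p.2) : big W)
  (GRing.isLinear.Build R (V * dual W)%type (big W) _ _ lin).
exact: (lfunE g p).
Qed.

Lemma pull_sndE p : pull_snd p = (p.1, (p.2 \o f)%VF).
Proof.
have lin : linear (fun p : V * dual W => (p.1, (p.2 \o f)%VF) : big V).
  by move=> a x y; rewrite /= comp_lfunDl -comp_lfunZl.
pose g : {linear (V * dual W)%type -> big V} := HB.pack
  (fun p : V * dual W => (p.1, (p.2 \o f)%VF) : big V)
  (GRing.isLinear.Build R (V * dual W)%type (big V) _ _ lin).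
exact: (lfunE g p).
Qed.

Lemma memv_pullback (U : {vspace cplx (big W)}) (z : cplx (big V)) :
  reflect (exists (X : cplx V) (eta : cplx (dual W)),
             Cplx (f (cre X), cre eta) (f (cim X), cim eta) \in U
          /\ z = Cplx (cre X, (cre eta \o f)%VF) (cim X, (cim eta \o f)%VF))
          (z \in pullback U).
Proof.
apply: (iffP memv_imgP) => [[[[x a] [y b]]]|[[x y] [[a b] /= [xU ->]]]].
  rewrite -memv_preim cextE !push_fstE /= => xU ->.
  by exists (Cplx x y), (Cplx a b); rewrite cextE !pull_sndE.
exists (Cplx (x, a) (y, b)); last by rewrite cextE !pull_sndE.
by rewrite -memv_preim cextE !push_fstE.
Qed.
End Pullback.

Definition subspace_incl (R : rcfType) (W : vectType R) (V : {vspace W}) :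
    'Hom(subvs_of V, W) :=
  linfun (vsval : subvs_of V -> W).

Definition generalized_hermitian_subspace (R : rcfType) (W : vectType R)
    (H J : 'End(big W)) (V : {vspace W}) : Prop :=
  defines_generalized_hermitian
    (pullback (subspace_incl V) (Lplus H J))
    (pullback (subspace_incl V) (Lminus H J)).

(* Main.v *)
Require Import Defs.
From HB Require Import structures.
From mathcomp Require Import all_boot all_order all_algebra reals.
From mathcomp Require Import complex.

Set Implicit Arguments.
Unset Strict Implicit.
Unset Printing Implicit Defensive.

Import Order.TTheory GRing.Theory Num.Theory.

Local Open Scope ring_scope.
Local Open Scope complex_scope.

(** Write theta_+- for psi +- gamma. The maps tau_+-X = (X, flat_theta_+- X)
    split big W orthogonally into a g-positive and a g-negative half, and
    J tau_+- = tau_+- J_+-, so that L_+- is the image under tau_+- of the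
    i-eigenspace of J_+- ([eigenspace_lift]). Such a pair of sections tau_+-
    restricts to every subspace V, by restricting theta_+-, and the pullback of
    L_+- is the image under the restricted tau_+- of the i-eigenvectors of J_+-
    that lie in V^c ([pullback_eigen_liftP]).

    If V is a generalized Hermitian subspace, write tau_+ X, for X in V, as a
    sum of elements of the four subspaces. The tau_+ and tau_- halves meet
    only in 0, so X = a + conj b with a, b eigenvectors of J_+ in V^c. On
    real parts of such eigenvectors J_+ gives back elements of V, hence J_+ X
    is in V; the same goes for J_- ([pullback_sum_full_stable]). Only the
    fullness of the sum enters.

    If V is stable, J_+- restrict to V, and it remains to see that two
    sections with compatible complex structures always define a generalized
    Hermitian structure ([frame_defines_hermitian]). Everything follows from
    three facts about the bilinear form: the eigenspace images are isotropic,
    the + and - images are orthogonal, and a vector x of one of them is zero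
    once it is orthogonal to conj x. The generalized metric is obtained from
    the product structure that is the identity on the + half and minus the
    identity on the - half. *)

(** * The canonical pairing and its complex extension *)

Section Pairing.
Variables (R : rcfType) (W : vectType R).
Implicit Types (x y : big W) (z : cplx (big W)).

Lemma gpairC x y : gpair x y = gpair y x.
Proof. by rewrite /gpair addrC. Qed.

Lemma gpairDl y : {morph @gpair R W ^~ y : x x' / x + x'}.
Proof.
by move=> x x'; rewrite /gpair /= add_lfunE linearD addrACA mulrDr.
Qed.

Lemma gpairZl a x y : gpair (a *: x) y = a * gpair x y.
Proof.
by rewrite /gpair /= scale_lfunE linearZ /= -mulrDr mulrCA.
Qed.

Lemma gpairDr x : {morph gpair x : y y' / y + y'}.
Proof. by move=> y y'; rewrite gpairC gpairDl !(gpairC x). Qed.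

Lemma gpairNl x y : gpair (- x) y = - gpair x y.
Proof. by rewrite -scaleN1r gpairZl mulN1r. Qed.

Lemma gpairNr x y : gpair x (- y) = - gpair x y.
Proof. by rewrite gpairC gpairNl gpairC. Qed.

Lemma cbil_gpairC z z' : cbil (@gpair R W) z z' = cbil (@gpair R W) z' z.
Proof.
case: z z' => x y [x' y']; rewrite /cbil /= (gpairC x x') (gpairC y y').
by rewrite (gpairC x y') (gpairC y x') [X in _ +i* X]addrC.
Qed.

Lemma cbil_gpairDl z1 z2 z' : cbil (@gpair R W) (z1 + z2) z' =
  cbil (@gpair R W) z1 z' + cbil (@gpair R W) z2 z'.
Proof.
rewrite /cbil creD cimD !gpairDl opprD addrACA.
by rewrite [X in _ +i* X]addrACA.
Qed.

Lemma cbil_gpairDr z z1 z2 : cbil (@gpair R W) z (z1 + z2) =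
  cbil (@gpair R W) z z1 + cbil (@gpair R W) z z2.
Proof. by rewrite cbil_gpairC cbil_gpairDl !(cbil_gpairC z). Qed.

End Pairing.

(** * Sums of subspaces *)

Lemma addv_self_eq0 (R : rcfType) (U : lmodType R) (w : U) : w + w = 0 -> w = 0.
Proof.
move/eqP; rewrite -mulr2n -scaler_nat scaler_eq0 pnatr_eq0 /=.
by move/eqP.
Qed.

Lemma directv_add4 (K : fieldType) (T : vectType K) (A B C D : {vspace T}) :
    (A :&: B = 0)%VS -> ((A + B) :&: C = 0)%VS ->
    ((A + B + C) :&: D = 0)%VS ->
  directv (A + B + C + D).
Proof.
by move=> AB ABC ABCD; rewrite directvE /= !dimv_disjoint_sum.
Qed.

Lemma addv_add4 (K : fieldType) (T : vectType K) (A B C D : {vspace T}) :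
  (A + B + C + D = (A + C) + (B + D))%VS.
Proof. by rewrite -!addvA; congr (A + _)%VS; rewrite !addvA (addvC B). Qed.

Lemma cplxv_add (R : rcfType) (U : vectType R) (A B : {vspace U}) :
  (cplxv (A + B) <= cplxv A + cplxv B)%VS.
Proof.
apply/subvP=> -[x y]; rewrite memv_cplxv /=.
case/andP=> /memv_addP[a aA [b bB ->]] /memv_addP[a' a'A [b' b'B ->]].
have -> : Cplx (a + b) (a' + b') = Cplx a a' + Cplx b b' by [].
by rewrite memv_add // memv_cplxv /=; apply/andP.
Qed.

(** * Lifted eigenspaces *)

(** With t = tau_+- and K = J_+- this is L_+-. *)
Definition eigen_lift (R : rcfType) (U B : vectType R) (t : 'Hom(U, B))
    (K : 'End(U)) : {vspace cplx B} :=
  (cext t @: leigenspace (cext K) 'i)%VS.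

Section EigenLift.
Variables (R : rcfType) (U B : vectType R) (t : 'Hom(U, B)).
Implicit Types (K : 'End(U)).

Lemma mem_eigen_cext (T : vectType R) (K : 'End(T)) (z : cplx T) :
  (z \in leigenspace (cext K) 'i) =
  (K (cre z) == - cim z) && (K (cim z) == cre z).
Proof.
case: z => x y; rewrite memv_leigenspace cextE cplx_scaleE /=.
rewrite !scale0r !scale1r !add0r.
by apply/eqP/andP => [[-> ->]|[/eqP -> /eqP ->]].
Qed.

(** An i-eigenvector of K is determined by its real part X, its imaginary part
    being - K X. This real parametrization reduces all later computations to
    the pairing on real vectors. *)
Lemma eigen_liftP K z : (forall X, K (K X) = - X) ->
  reflect (exists X, z = Cplx (t X) (- t (K X))) (z \in eigen_lift t K).
Proof.
move=> K2; apply: (iffP memv_imgP) => [[[x y]]|[X ->]].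
  rewrite mem_eigen_cext /= => /andP[/eqP Kx _] ->; exists x.
  by rewrite cextE /= Kx linearN opprK.
exists (Cplx X (- K X)); last by rewrite cextE /= linearN.
by rewrite mem_eigen_cext /= (linearN K) /= K2 !opprK !eqxx.
Qed.

Lemma opp_square K : (forall X, K (K X) = - X) ->
  forall X, (- K) ((- K) X) = - X.
Proof. by move=> K2 X; rewrite !opp_lfunE (linearN K) /= opprK K2. Qed.

Lemma conjv_eigen_lift K : (forall X, K (K X) = - X) ->
  conjv (eigen_lift t K) = eigen_lift t (- K).
Proof.
move=> K2; apply/vspaceP => z; rewrite memv_conjv.
apply/(eigen_liftP _ K2)/(eigen_liftP _ (opp_square K2)) => -[X].
  move/(congr1 (@cconj _)); rewrite cconjK => ->; exists X.
  by rewrite /cconj /= opp_lfunE (linearN t).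
by move=> ->; exists X; rewrite /cconj /= opp_lfunE (linearN t) opprK.
Qed.

Lemma cconj_eigen_lift K z : (forall X, K (K X) = - X) ->
  z \in eigen_lift t (- K) -> cconj z \in eigen_lift t K.
Proof. by move=> K2; rewrite -conjv_eigen_lift // memv_conjv. Qed.

(** The i- and (-i)-eigenspaces of a complex structure span the
    complexification. *)
Lemma eigen_liftD K : (forall X, K (K X) = - X) ->
  (eigen_lift t K + eigen_lift t (- K) = cplxv (limg t))%VS.
Proof.
move=> K2; have NK2 := opp_square K2.
apply/eqP; rewrite eqEsubv; apply/andP; split.
  by apply/subvP=> z /memv_addP[_ /(eigen_liftP _ K2)[X ->]
    [_ /(eigen_liftP _ NK2)[Y ->] ->]];
  rewrite memv_cplxv /= memvD ?memvB ?memvN ?memv_img ?memvf.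
apply/subvP=> -[u v]; rewrite memv_cplxv /=.
case/andP=> /memv_imgP[x _ ->] /memv_imgP[y _ ->] {u v}.
have half2 (w : U) : 2^-1 *: (w + w) = w.
  by rewrite -mulr2n -scaler_nat scalerA mulVf ?scale1r // pnatr_eq0.
(* the components of Z = x + iy on the i- and (-i)-eigenspaces of K are
   (Z - i K Z) / 2 and (Z + i K Z) / 2; a and b are their real parts *)
pose a := 2^-1 *: (x + K y); pose b := 2^-1 *: (x - K y).
have abx : a + b = x by rewrite -scalerDr addrACA subrr addr0 half2.
have aby : K b - K a = y.
  rewrite /a /b !linearZ /= -scalerDr !(linearD K) /= (linearN K) /= !K2.
  by rewrite opprD !opprK addrACA subrr add0r half2.
apply/memv_addP; exists (Cplx (t a) (- t (K a))).
  by apply/eigen_liftP => //; exists a.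
exists (Cplx (t b) (- t ((- K) b))); first by apply/eigen_liftP => //; exists b.
rewrite -abx -aby opp_lfunE linearD linearB linearN opprK.
by rewrite [X in Cplx _ X]addrC.
Qed.

End EigenLift.

(** * Frames of a generalized metric *)

(** The data of a generalized metric, as two parametrized halves of [big U]
    rather than as a pair (gamma, psi): in this form it passes to subspaces
    without computing with the two tensors. *)
Record metric_frame (R : rcfType) (U : vectType R)
    (tp tm : 'Hom(U, big U)) : Prop := MetricFrame {
  frame_orth : forall X Y, gpair (tp X) (tm Y) = 0;
  frame_pos : forall X, X != 0 -> 0 < gpair (tp X) (tp X);
  frame_neg : forall X, X != 0 -> gpair (tm X) (tm X) < 0 }.

Definition lift_definite (R : rcfType) (U : vectType R)
    (t : 'Hom(U, big U)) : Prop :=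
  forall X, gpair (t X) (t X) = 0 -> X = 0.

(** Compatibility of K with the metric g(t -, t -), which is gamma or
    - gamma. *)
Record lift_hermitian (R : rcfType) (U : vectType R)
    (t : 'Hom(U, big U)) (K : 'End(U)) : Prop := LiftHermitian {
  lift_square : forall X, K (K X) = - X;
  lift_skew : forall X Y, gpair (t (K X)) (t Y) = - gpair (t X) (t (K Y)) }.

Section Isotropy.
Variables (R : rcfType) (U : vectType R).
Implicit Types (t : 'Hom(U, big U)) (K : 'End(U)).
Local Notation cg := (cbil (@gpair R U)).

Lemma definite_lker0 t : lift_definite t -> lker t == 0%VS.
Proof.
move=> def_t; apply/eqP/vspaceP=> x; rewrite memv_ker memv0.
apply/eqP/eqP => [tx|->]; last by rewrite linear0.
by apply: def_t; rewrite tx -(scale0r 0) gpairZl mul0r.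
Qed.

Lemma lift_hermitianN t K : lift_hermitian t K -> lift_hermitian t (- K).
Proof.
case=> K2 Ksk; split; first exact: opp_square.
by move=> X Y; rewrite !opp_lfunE !linearN gpairNl Ksk gpairNr.
Qed.

Lemma lift_isometry t K : lift_hermitian t K ->
  forall X Y, gpair (t (K X)) (t (K Y)) = gpair (t X) (t Y).
Proof. by case=> K2 Ksk X Y; rewrite Ksk K2 linearN gpairNr opprK. Qed.

(** K preserves the metric, so for the lifts of X - i K X and Y - i K Y the
    real parts cancel; skewness cancels the imaginary parts. *)
Lemma eigen_lift_isotropic t K : lift_hermitian t K ->
  isotropic (eigen_lift t K).
Proof.
move=> hK x y; have [K2 Ksk] := hK.
case/(eigen_liftP _ _ K2)=> X -> /(eigen_liftP _ _ K2)[Y ->].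
rewrite /cbil /= !gpairNl !gpairNr opprK (lift_isometry hK) Ksk.
by rewrite opprK addNr subrr.
Qed.

(** For x the lift of X - i K X, the pairing of x with its conjugate is
    2 g(t X, t X). *)
Lemma eigen_lift_nondeg t K x : lift_definite t -> lift_hermitian t K ->
  x \in eigen_lift t K -> cg x (cconj x) = 0 -> x = 0.
Proof.
move=> def_t hK; have [K2 Ksk] := hK.
case/(eigen_liftP _ _ K2)=> X ->; rewrite /cbil /= !gpairNl !gpairNr !opprK.
rewrite (lift_isometry hK) => /(congr1 (@complex.Re R)) /=.
rewrite -mulr2n => /eqP; rewrite mulrn_eq0 /= => /eqP /def_t ->.
by rewrite !linear0.
Qed.

End Isotropy.

Section Frame.
Variables (R : rcfType) (U : vectType R) (tp tm : 'Hom(U, big U)).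
Hypothesis frame : metric_frame tp tm.
Local Notation cg := (cbil (@gpair R U)).

Lemma frame_definite_p : lift_definite tp.
Proof.
move=> X g0; apply/eqP; apply: contraT => /(frame_pos frame).
by rewrite g0 ltxx.
Qed.

Lemma frame_definite_m : lift_definite tm.
Proof.
move=> X g0; apply/eqP; apply: contraT => /(frame_neg frame).
by rewrite g0 ltxx.
Qed.

Lemma frame_cap0 : (limg tp :&: limg tm = 0)%VS.
Proof.
apply/eqP; rewrite -subv0; apply/subvP=> x; rewrite memv_cap memv0.
case/andP=> /memv_imgP[X _ ->] /memv_imgP[Y _ eqXY].
suff -> : X = 0 by rewrite linear0.
by apply: frame_definite_p; rewrite {2}eqXY (frame_orth frame).
Qed.

(** Both maps are injective, so the two halves have the dimension of U,
    and [big U] has twice that dimension. *)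
Lemma frame_full : (limg tp + limg tm = fullv)%VS.
Proof.
apply/eqP; rewrite eqEdim subvf /= dimv_disjoint_sum ?frame_cap0 //.
rewrite !limg_dim_eq.
- have dimB : dim (big U) = (dim U + dim U * 1)%N by [].
  by rewrite !dimvf dimB muln1.
- by rewrite (eqP (definite_lker0 frame_definite_m)) capv0.
- by rewrite (eqP (definite_lker0 frame_definite_p)) capv0.
Qed.

Lemma eigen_lift_orth (K K' : 'End(U)) x y :
  (forall X, K (K X) = - X) -> (forall X, K' (K' X) = - X) ->
  x \in eigen_lift tp K -> y \in eigen_lift tm K' -> cg x y = 0.
Proof.
move=> K2 K2' /(eigen_liftP _ _ K2)[X ->] /(eigen_liftP _ _ K2')[Y ->].
rewrite /cbil /= !gpairNl !gpairNr !(frame_orth frame).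
by rewrite !oppr0 addr0.
Qed.

Section Hermitian.
Variables Kp Km : 'End(U).
Hypotheses (hp : lift_hermitian tp Kp) (hm : lift_hermitian tm Km).
Local Notation Lp := (eigen_lift tp Kp).
Local Notation Lm := (eigen_lift tm Km).
Local Notation Lp' := (eigen_lift tp (- Kp)).
Local Notation Lm' := (eigen_lift tm (- Km)).

Lemma frame_eigen_full : (Lp + Lm + Lp' + Lm' = fullv)%VS.
Proof.
have [p2 m2] := (lift_square hp, lift_square hm).
rewrite addv_add4 (congr2 (@addv _ _) (eigen_liftD tp p2) (eigen_liftD tm m2)).
apply/eqP; rewrite eqEsubv subvf; apply: subv_trans (cplxv_add _ _).
by rewrite frame_full; apply/subvP=> z _; rewrite memv_cplxv !memvf.
Qed.

Lemma frame_eigen_isotropic : isotropic (Lp + Lm)%VS.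
Proof.
have [[p2 _] [m2 _]] := (hp, hm).
move=> _ _ /memv_addP[a aL [b bL ->]] /memv_addP[c cL [d dL ->]].
rewrite cbil_gpairDl !cbil_gpairDr (cbil_gpairC b c).
rewrite (eigen_lift_isotropic hp aL cL) (eigen_lift_isotropic hm bL dL).
by rewrite (eigen_lift_orth p2 m2 aL dL) (eigen_lift_orth p2 m2 cL bL) !addr0.
Qed.

End Hermitian.

(** Modulo the isotropic subspace Lp + Lm, an element of an isotropic E that
    contains it is a sum c + d of conjugates of elements of Lp and Lm. Pairing
    c + d with conj c and with conj d, which lie in E, kills c and d in turn.
    Both Dirac conditions are instances, the second one for - Km. *)
Lemma frame_dirac Kp Km : lift_hermitian tp Kp -> lift_hermitian tm Km ->
  dirac (eigen_lift tp Kp + eigen_lift tm Km)%VS.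
Proof.
move=> hp hm; have [[p2 _] [m2 _]] := (hp, hm).
have [hp' hm'] := (lift_hermitianN hp, lift_hermitianN hm).
have [[p2' _] [m2' _]] := (hp', hm').
set Lp := eigen_lift tp Kp; set Lm := eigen_lift tm Km.
split; first exact: frame_eigen_isotropic.
move=> E isoE LE; apply/eqP; rewrite eqEsubv LE andbT.
have [LpE LmE] : (Lp <= E)%VS /\ (Lm <= E)%VS by apply/andP; rewrite -subv_add.
apply/subvP=> z; have := memvf z; rewrite -(frame_eigen_full hp hm).
case/memv_addP=> _ /memv_addP[a aL [c cL ->]] [d dL ->] zE.
have cdE : c + d \in E.
  have -> : c + d = a + c + d - a by rewrite -(addrA a) [a + _]addrC addrK.
  by rewrite memvB // (subvP LE).
have c'L : cconj c \in Lp by apply: (cconj_eigen_lift p2 cL).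
have d'L : cconj d \in Lm by apply: (cconj_eigen_lift m2 dL).
have c0 : c = 0.
  apply: (eigen_lift_nondeg frame_definite_p hp' cL).
  have := isoE _ _ cdE (subvP LpE _ c'L); rewrite cbil_gpairDl.
  by rewrite (cbil_gpairC d) (eigen_lift_orth p2 m2' c'L dL) addr0.
have d0 : d = 0.
  apply: (eigen_lift_nondeg frame_definite_m hm' dL).
  have := isoE _ _ cdE (subvP LmE _ d'L); rewrite cbil_gpairDl.
  by rewrite (eigen_lift_orth p2' m2 cL d'L) add0r.
by rewrite c0 d0 !addr0.
Qed.

(** Each summand meets the sum of the preceding ones in vectors that are
    orthogonal to their own conjugate. *)
Lemma frame_eigen_direct Kp Km :
  lift_hermitian tp Kp -> lift_hermitian tm Km ->
  directv (eigen_lift tp Kp + eigen_lift tm Km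
           + eigen_lift tp (- Kp) + eigen_lift tm (- Km)).
Proof.
move=> hp hm; have [[p2 _] [m2 _]] := (hp, hm).
have [hp' hm'] := (lift_hermitianN hp, lift_hermitianN hm).
have [[p2' _] [m2' _]] := (hp', hm').
set Lp := eigen_lift tp Kp; set Lm := eigen_lift tm Km.
set Lp' := eigen_lift tp _; set Lm' := eigen_lift tm _.
have capP (A B : {vspace cplx (big U)}) :
    (forall x, x \in A -> x \in B -> x = 0) -> (A :&: B = 0)%VS.
  move=> AB0; apply/eqP; rewrite -subv0; apply/subvP=> x.
  by rewrite memv_cap memv0 => /andP[xA xB]; apply/eqP/AB0.
have cap1 : (Lp :&: Lm = 0)%VS.
  apply: capP => x xp xm; apply: (eigen_lift_nondeg frame_definite_p hp xp).
  apply: (eigen_lift_orth p2 m2' xp).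
  by apply: (cconj_eigen_lift m2'); rewrite opprK.
have cap2 : ((Lp + Lm) :&: Lp' = 0)%VS.
  apply: capP => x xL xp'; apply: (eigen_lift_nondeg frame_definite_p hp' xp').
  have cxL : cconj x \in (Lp + Lm)%VS.
    exact: (subvP (addvSl Lp Lm) _ (cconj_eigen_lift p2 xp')).
  exact: (frame_eigen_isotropic hp hm xL cxL).
have cap3 : ((Lp + Lm + Lp') :&: Lm' = 0)%VS.
  apply: capP => x xL xm'; apply: (eigen_lift_nondeg frame_definite_m hm' xm').
  have cxL := cconj_eigen_lift m2 xm'.
  case/memv_addP: xL => y yL [w wL eqx]; rewrite {1}eqx cbil_gpairDl.
  rewrite (eigen_lift_orth p2' m2 wL cxL) addr0.
  have cxL' : cconj x \in (Lp + Lm)%VS := subvP (addvSr Lp Lm) _ cxL.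
  exact: (frame_eigen_isotropic hp hm yL cxL').
exact: directv_add4.
Qed.

(** * The generalized metric of a frame *)

(** A positive subspace that contains the positive half contains the negative
    component of each of its elements, which must therefore vanish. *)
Lemma frame_max_positive : maximal_sub (@g_positive R U) (limg tp).
Proof.
split=> [_ /memv_imgP[X _ ->] nz|E posE sub].
  by apply: (frame_pos frame); apply: contra_neq nz => ->; rewrite linear0.
apply/eqP; rewrite eqEsubv sub andbT; apply/subvP=> z zE.
have : z \in (limg tp + limg tm)%VS by rewrite frame_full memvf.
case/memv_addP=> a ap [_ /memv_imgP[Y _ ->] eqz].
have YE : tm Y \in E.
  by rewrite -[tm Y](addKr a) -eqz memvD ?memvN // (subvP sub).
have [Y0|nzY] := eqVneq Y 0; first by rewrite eqz Y0 linear0 addr0.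
have nz : tm Y != 0.
  apply: contra_neq nzY => tY0; apply: frame_definite_m.
  by rewrite tY0 -(scale0r 0) gpairZl mul0r.
by have := lt_trans (posE _ YE nz) (frame_neg frame nzY); rewrite ltxx.
Qed.

Lemma frame_max_negative : maximal_sub (@g_negative R U) (limg tm).
Proof.
split=> [_ /memv_imgP[X _ ->] nz|E negE sub].
  by apply: (frame_neg frame); apply: contra_neq nz => ->; rewrite linear0.
apply/eqP; rewrite eqEsubv sub andbT; apply/subvP=> z zE.
have : z \in (limg tp + limg tm)%VS by rewrite frame_full memvf.
case/memv_addP=> _ /memv_imgP[Y _ ->] [a am eqz].
have YE : tp Y \in E by rewrite -[tp Y](addrK a) -eqz memvB // (subvP sub).
have [Y0|nzY] := eqVneq Y 0; first by rewrite eqz Y0 linear0 add0r.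
have nz : tp Y != 0.
  apply: contra_neq nzY => tY0; apply: frame_definite_p.
  by rewrite tY0 -(scale0r 0) gpairZl mul0r.
by have := lt_trans (frame_pos frame nzY) (negE _ YE nz); rewrite ltxx.
Qed.

Definition frame_product : 'End(big U) :=
  daddv_pi (limg tp) (limg tm) - daddv_pi (limg tm) (limg tp).

Lemma frame_product_p x : x \in limg tp -> frame_product x = x.
Proof.
move=> xp; rewrite add_lfunE opp_lfunE daddv_pi_id ?frame_cap0 //.
suff -> : daddv_pi (limg tm) (limg tp) x = 0 by rewrite subr0.
apply: (addrI (daddv_pi (limg tp) (limg tm) x)).
rewrite daddv_pi_add ?frame_cap0 ?frame_full ?memvf //.
by rewrite daddv_pi_id ?frame_cap0 // addr0.
Qed.

Lemma frame_product_m x : x \in limg tm -> frame_product x = - x.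
Proof.
have cap0 : (limg tm :&: limg tp = 0)%VS by rewrite capvC frame_cap0.
move=> xm; rewrite add_lfunE opp_lfunE [X in _ - X]daddv_pi_id //.
suff -> : daddv_pi (limg tp) (limg tm) x = 0 by rewrite add0r.
apply: (addrI (daddv_pi (limg tm) (limg tp) x)).
rewrite daddv_pi_add ?cap0 ?(addvC (limg tm)) ?frame_full ?memvf //.
by rewrite daddv_pi_id // addr0.
Qed.

Lemma frame_productB x y : x \in limg tp -> y \in limg tm ->
  frame_product (x + y) = x - y.
Proof.
by move=> xp ym; rewrite linearD /= frame_product_p // frame_product_m.
Qed.

Lemma frame_split x : exists a b, [/\ a \in limg tp, b \in limg tm & x = a + b].
Proof.
have : x \in (limg tp + limg tm)%VS by rewrite frame_full memvf.
by case/memv_addP=> a ap [b bm ->]; exists a, b.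
Qed.

Lemma frame_inj X X' Y Y' : tp X + tm Y = tp X' + tm Y' -> X = X' /\ Y = Y'.
Proof.
move/eqP; rewrite -subr_eq0 opprD addrACA -!linearB /= addr_eq0 => /eqP E.
have inj (t : 'Hom(U, big U)) Z : lift_definite t -> t Z = 0 -> Z = 0.
  move=> /definite_lker0 /eqP ker0 tZ; apply/eqP.
  by rewrite -memv0 -ker0 memv_ker tZ.
have tX : tp (X - X') = 0.
  apply/eqP; rewrite -memv0 -frame_cap0 memv_cap memv_img ?memvf //.
  by rewrite E -linearN memv_img ?memvf.
have tY : tm (Y - Y') = 0 by apply/eqP; rewrite -oppr_eq0 -E tX.
by split; apply/eqP; rewrite -subr_eq0; apply/eqP;
  [apply: (inj tp) tX; apply: frame_definite_p
  | apply: (inj tm) tY; apply: frame_definite_m].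
Qed.

Lemma frame_product_eigen_p : leigenspace frame_product 1 = limg tp.
Proof.
apply/vspaceP=> x; rewrite memv_leigenspace scale1r; apply/eqP/idP; last first.
  exact: frame_product_p.
have [a [b [ap bm ->]]] := frame_split x.
rewrite frame_productB // => /addrI Nb.
by rewrite (addv_self_eq0 (w := b)) ?addr0 // -{1}Nb addNr.
Qed.

Lemma frame_product_eigen_m : leigenspace frame_product (-1) = limg tm.
Proof.
apply/vspaceP=> x; rewrite memv_leigenspace scaleN1r; apply/eqP/idP; last first.
  exact: frame_product_m.
have [a [b [ap bm ->]]] := frame_split x.
rewrite frame_productB // opprD => /addIr Na.
by rewrite (addv_self_eq0 (w := a)) ?add0r // {1}Na addNr.
Qed.

Lemma frame_orthv a b : a \in limg tp -> b \in limg tm -> gpair a b = 0.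
Proof. by case/memv_imgP=> X _ -> /memv_imgP[Y _ ->]; apply: frame_orth. Qed.

Definition frame_metric (x y : big U) : R := 2 * gpair (frame_product x) y.

Lemma frame_metric_sym x y : frame_metric x y = frame_metric y x.
Proof.
have [a [b [ap bm ->]]] := frame_split x.
have [c [d [cp dm ->]]] := frame_split y.
rewrite /frame_metric !frame_productB // !gpairDl !gpairDr !gpairNl.
rewrite (gpairC b c) (gpairC d a) (frame_orthv ap dm) (frame_orthv cp bm).
by rewrite (gpairC c a) (gpairC d b).
Qed.

Lemma frame_metric_gt0 x : x != 0 -> 0 < frame_metric x x.
Proof.
have [a [b [ap bm ->]]] := frame_split x => nz.
rewrite /frame_metric frame_productB // gpairDl !gpairDr !gpairNl.
rewrite (gpairC b a) (frame_orthv ap bm) oppr0 addr0 add0r.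
case/memv_imgP: ap nz => X _ ->; case/memv_imgP: bm => Y _ -> nz.
rewrite mulr_gt0 //.
have [X0|nzX] := eqVneq X 0; last first.
  apply: ltr_wpDr (frame_pos frame nzX); rewrite oppr_ge0.
  have [->|nzY] := eqVneq Y 0; last exact: ltW (frame_neg frame nzY).
  by rewrite linear0 -(scale0r 0) gpairZl mul0r.
rewrite X0 linear0 add0r in nz.
rewrite X0 linear0 -(scale0r 0) gpairZl mul0r add0r oppr_gt0.
by apply: (frame_neg frame); apply: contra_neq nz => ->; rewrite linear0.
Qed.

Lemma frame_metric_dot : exists G : {dot big U for idfun},
  forall x y, G x y = frame_metric x y.
Proof.
have bil : bilinear_for (GRing.Scale.Law.clone _ _ *%R _)
    (GRing.Scale.Law.clone _ _ (idfun \; *%R) _) frame_metric.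
  split=> [y|x] a u v; rewrite /frame_metric /=.
    by rewrite linearP gpairDl gpairZl mulrDr mulrCA.
  by rewrite gpairDr (gpairC _ (_ *: _)) gpairZl gpairC mulrDr mulrCA.
have herm x y : frame_metric x y = (-1) ^+ false * idfun (frame_metric y x).
  by rewrite mul1r frame_metric_sym.
pose G : {dot big U for idfun} := HB.pack frame_metric
  (bilinear_isBilinear.Build _ _ _ _ _ _ frame_metric bil)
  (isHermitianSesquilinear.Build _ _ _ _ frame_metric herm)
  (isDotProduct.Build _ _ frame_metric frame_metric_gt0).
by exists G.
Qed.

Lemma frame_generalized_metric : exists G, generalized_metric G frame_product.
Proof.
have [G GE] := frame_metric_dot; exists G, (limg tp), (limg tm).
split; [split | exact: frame_product_p | exact: frame_product_m].
- exact: frame_full.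
- exact/directv_addP/frame_cap0.
- exact: frame_max_positive.
- exact: frame_max_negative.
- exact: frame_orthv.
- move=> x y xp ym; rewrite GE /frame_metric frame_product_p //.
  by rewrite frame_orthv ?mulr0.
- by move=> x y xp yp; rewrite GE /frame_metric frame_product_p.
- move=> x y xm ym; rewrite GE /frame_metric frame_product_m //.
  by rewrite gpairNl mulrN.
Qed.

(** Naming the conjugates keeps conversion from comparing spans of explicit
    generators. *)
Lemma defines_hermitian_conj (Lp Lm Lp' Lm' : {vspace cplx (big U)}) :
    conjv Lp = Lp' -> conjv Lm = Lm' ->
    (Lp + Lm + Lp' + Lm' = fullv)%VS -> directv (Lp + Lm + Lp' + Lm') ->
    dirac (Lp + Lm) -> dirac (Lp + Lm') ->
    (exists G H, [/\ generalized_metric G H,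
       (Lp + Lp' = cplxv (leigenspace H 1))%VS
     & (Lm + Lm' = cplxv (leigenspace H (-1)))%VS]) ->
  defines_generalized_hermitian Lp Lm.
Proof. by move=> <- <-. Qed.

Lemma frame_defines_hermitian Kp Km :
    lift_hermitian tp Kp -> lift_hermitian tm Km ->
  defines_generalized_hermitian (eigen_lift tp Kp) (eigen_lift tm Km).
Proof.
move=> hp hm; have [[p2 _] [m2 _]] := (hp, hm).
apply: (defines_hermitian_conj (conjv_eigen_lift tp p2)
                               (conjv_eigen_lift tm m2)).
- exact: (frame_eigen_full hp hm).
- exact: (frame_eigen_direct hp hm).
- exact: (frame_dirac hp hm).
- exact: (frame_dirac hp (lift_hermitianN hm)).
have [G hG] := frame_generalized_metric; exists G, frame_product.
rewrite frame_product_eigen_p frame_product_eigen_m.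
split; [exact: hG | exact: (eigen_liftD tp p2) | exact: (eigen_liftD tm m2)].
Qed.

End Frame.

(** * Restriction to a subspace *)

Definition lift_section (R : rcfType) (U : vectType R) (t : 'Hom(U, big U)) :
  Prop := forall X, (t X).1 = X.

Section Restriction.
Variables (R : rcfType) (W : vectType R) (V : {vspace W}).
Local Notation incl := (subspace_incl V).
Implicit Types (t : 'Hom(W, big W)) (K : 'End(W)) (X Y : subvs_of V).

Lemma subspace_inclE X : incl X = vsval X.
Proof. exact: lfunE. Qed.

(** If t lifts X to (X, flat_theta X), this lifts X in V to (X, flat_theta' X)
    with theta' the restriction of theta to V. *)
Definition restrict_lift t : 'Hom(subvs_of V, big (subvs_of V)) :=
  linfun (fun X : subvs_of V =>
            (X, ((t (vsval X)).2 \o incl)%VF) : big (subvs_of V)).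

Lemma restrict_liftE t X :
  restrict_lift t X = (X, ((t (vsval X)).2 \o incl)%VF).
Proof.
have lin : linear (fun X : subvs_of V =>
    (X, ((t (vsval X)).2 \o incl)%VF) : big (subvs_of V)).
  by move=> a x y; rewrite !linearP /= comp_lfunDl -comp_lfunZl.
pose g : {linear subvs_of V -> big (subvs_of V)} := HB.pack
  (fun X : subvs_of V => (X, ((t (vsval X)).2 \o incl)%VF) : big (subvs_of V))
  (GRing.isLinear.Build R (subvs_of V) (big (subvs_of V)) _ _ lin).
exact: (lfunE g X).
Qed.

Lemma gpair_restrict t s X Y : lift_section t -> lift_section s ->
  gpair (restrict_lift t X) (restrict_lift s Y) =
  gpair (t (vsval X)) (s (vsval Y)).
Proof.
move=> tS sS; rewrite !restrict_liftE /gpair /= !comp_lfunE !subspace_inclE.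
by rewrite tS sS.
Qed.

Lemma restrict_frame tp tm : lift_section tp -> lift_section tm ->
  metric_frame tp tm -> metric_frame (restrict_lift tp) (restrict_lift tm).
Proof.
move=> tpS tmS [o pos neg].
split=> [X Y|X nzX|X nzX]; rewrite gpair_restrict //.
  exact: pos.
exact: neg.
Qed.

Definition restrict_endo K : 'End(subvs_of V) :=
  (linfun (vsproj V) \o K \o incl)%VF.

Lemma restrict_endoE K X : (K @: V <= V)%VS ->
  vsval (restrict_endo K X) = K (vsval X).
Proof.
move=> KV; rewrite !comp_lfunE lfunE /= subspace_inclE vsprojK //.
by rewrite (subvP KV) // memv_img ?subvsP.
Qed.

Lemma restrict_hermitian t K : (K @: V <= V)%VS -> lift_section t ->
  lift_hermitian t K -> lift_hermitian (restrict_lift t) (restrict_endo K).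
Proof.
move=> KV tS [K2 Ksk]; split=> [X|X Y].
  by apply: val_inj; rewrite /= !restrict_endoE.
by rewrite !gpair_restrict // !restrict_endoE.
Qed.

(** The covector of an element of the lifted eigenspace is determined by its
    vector, so pulling back only constrains X + iY to be an eigenvector
    that lies in V^c. *)
Lemma pullback_eigen_liftP t K z : lift_section t ->
    (forall x, K (K x) = - x) ->
  reflect (exists X Y, K (vsval X) = - vsval Y /\
             z = Cplx (restrict_lift t X) (restrict_lift t Y))
          (z \in pullback incl (eigen_lift t K)).
Proof.
move=> tS K2; apply: (iffP (memv_pullback _ _ _)).
  case=> -[x y] [[a b]] /= [/(eigen_liftP _ _ K2)[w]].
  rewrite !subspace_inclE => -[xa yb eb] ->.
  have wx : w = vsval x by rewrite -[w]tS -xa.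
  have yw : K w = - vsval y by rewrite yb tS opprK.
  exists x, y; split; first by rewrite -wx.
  rewrite !restrict_liftE -wx -xa -[vsval y]opprK -yw linearN /= eb.
  by [].
case=> X [Y [KX ->]].
exists (Cplx X Y), (Cplx (t (vsval X)).2 (t (vsval Y)).2) => /=; split.
  apply/(eigen_liftP _ _ K2); exists (vsval X).
  have tE v : (v, (t v).2) = t v by rewrite [RHS]surjective_pairing tS.
  by rewrite !subspace_inclE KX linearN opprK /= !tE.
by rewrite !restrict_liftE.
Qed.

Lemma pullback_eigen_lift t K : (K @: V <= V)%VS -> lift_section t ->
    (forall x, K (K x) = - x) ->
  pullback incl (eigen_lift t K) =
  eigen_lift (restrict_lift t) (restrict_endo K).
Proof.
move=> KV tS K2.
have KV2 X : restrict_endo K (restrict_endo K X) = - X.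
  by apply: val_inj; rewrite /= !restrict_endoE.
apply/vspaceP=> z.
apply/(pullback_eigen_liftP _ tS K2)/(eigen_liftP _ _ KV2).
  case=> X [Y [KX ->]].
  exists X; rewrite -linearN; congr (Cplx _ (restrict_lift t _)).
  by apply: val_inj; rewrite /= restrict_endoE // KX opprK.
case=> X ->; exists X, (- restrict_endo K X); split; last by rewrite linearN.
by rewrite linearN /= restrict_endoE // opprK.
Qed.

(** The real part of an eigenvector of K that lies in V^c is sent into V by
    K. As the four pullbacks span, each vector of V is a sum of such real parts,
    the components along the two halves being unique. *)
Lemma pullback_sum_full_stable (tp tm : 'Hom(W, big W)) (Kp Km : 'End(W)) :
    metric_frame tp tm -> lift_section tp -> lift_section tm ->
    (forall x, Kp (Kp x) = - x) -> (forall x, Km (Km x) = - x) ->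
    (pullback incl (eigen_lift tp Kp) + pullback incl (eigen_lift tm Km)
     + conjv (pullback incl (eigen_lift tp Kp))
     + conjv (pullback incl (eigen_lift tm Km)) = fullv)%VS ->
  (Kp @: V <= V)%VS /\ (Km @: V <= V)%VS.
Proof.
move=> frame tpS tmS p2 m2 full.
have frameV := restrict_frame tpS tmS frame.
have real_part t K z : lift_section t -> (forall x, K (K x) = - x) ->
    z \in pullback incl (eigen_lift t K) ->
    exists2 X, cre z = restrict_lift t X & K (vsval X) \in V.
  move=> tS K2 /(pullback_eigen_liftP _ tS K2)[X [Y [KX ->]]].
  by exists X; rewrite // KX memvN subvsP.
have split_real v : exists X Y, [/\ v = restrict_lift tp X + restrict_lift tm Y,
    Kp (vsval X) \in V & Km (vsval Y) \in V].
  have : Cplx v 0 \in fullv by exact: memvf.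
  rewrite -full.
  case/memv_addP=> _ /memv_addP[_ /memv_addP[a aL [b bL ->]] [c cL ->]].
  case=> d dL /(congr1 (@cre _)) /= ->.
  move: cL dL; rewrite !memv_conjv => cL dL.
  have [X aX XV] := real_part _ _ _ tpS p2 aL.
  have [X' cX X'V] := real_part _ _ _ tpS p2 cL.
  have [Y bY YV] := real_part _ _ _ tmS m2 bL.
  have [Y' dY Y'V] := real_part _ _ _ tmS m2 dL.
  exists (X + X'), (Y + Y'); split; try by rewrite !linearD /= memvD.
  rewrite !linearD /= -aX -bY -cX -dY.
  by rewrite -addrA addrACA.
split; apply/subvP=> _ /memv_imgP[x xV ->]; rewrite -[x](vsprojK xV).
  have [X [Y [E XV _]]] := split_real (restrict_lift tp (vsproj V x)).
  rewrite -[restrict_lift tp _]addr0 -(linear0 (restrict_lift tm)) in E.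
  by have [-> _] := frame_inj frameV E.
have [X [Y [E _ YV]]] := split_real (restrict_lift tm (vsproj V x)).
rewrite -[restrict_lift tm _]add0r -(linear0 (restrict_lift tp)) in E.
by have [_ ->] := frame_inj frameV E.
Qed.

End Restriction.

(** * The quadruple of a generalized Hermitian structure *)

Lemma square_opp_stable (R : rcfType) (W : vectType R) (V : {vspace W})
    (K : 'End(W)) : (forall x, K (K x) = - x) ->
  (K @: V <= V)%VS <-> (K @: V = V)%VS.
Proof.
move=> K2; split=> [KV|->//]; apply/eqP; rewrite eqEsubv KV /=.
apply/subvP=> x xV; apply/memv_imgP; exists (- K x).
  by rewrite memvN (subvP KV) // memv_img.
by rewrite linearN /= K2 opprK.
Qed.

Section Quadruple.
Variables (R : rcfType) (W : vectType R).

Definition tau_lift (theta : W -> W -> R) : 'Hom(W, big W) :=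
  linfun (tau theta).

Definition bilinear_fun (theta : W -> W -> R) : Prop :=
  (forall X, scalar (theta X)) /\ (forall Y, scalar (theta ^~ Y)).

Lemma tau_liftE theta X : bilinear_fun theta -> tau_lift theta X = tau theta X.
Proof.
move=> [linr linl].
have lin : linear (tau theta).
  move=> a x y; congr pair; apply/lfunP=> Y.
  by rewrite flatE // linl add_lfunE scale_lfunE !flatE.
pose g : {linear W -> big W} := HB.pack (tau theta)
  (GRing.isLinear.Build R W (big W) _ _ lin).
exact: (lfunE g X).
Qed.

Lemma gpair_tau theta theta' X Y : bilinear_fun theta -> bilinear_fun theta' ->
  gpair (tau theta X) (tau theta' Y) = 2^-1 * (theta X Y + theta' Y X).
Proof. by move=> [lr _] [lr' _]; rewrite /gpair /= !flatE. Qed.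

(** J commutes with H, so it preserves the eigenspace of H parametrized by t,
    and as t is a section it acts there as K. *)
Lemma eigenspace_lift (H J : 'End(big W)) (t : 'Hom(W, big W)) (K : 'End(W))
    (e : R) :
    generalized_complex J -> (J \o H = H \o J)%VF -> lift_section t ->
    (forall x, x \in leigenspace H e <-> exists X, x = t X) ->
    (forall X, K X = (J (t X)).1) ->
  lift_hermitian t K /\
  (leigenspace (cext J) 'i :&: cplxv (leigenspace H e))%VS = eigen_lift t K.
Proof.
move=> [J2 Jsk] JH tS eigE KE.
have JtE X : J (t X) = t (K X).
  have : J (t X) \in leigenspace H e.
    have tX : t X \in leigenspace H e by apply/eigE; exists X.
    have /lfunP/(_ (t X)) := JH; rewrite !comp_lfunE memv_leigenspace => <-.
    by move: tX; rewrite memv_leigenspace => /eqP ->; rewrite linearZ.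
  by case/eigE=> Y E; rewrite KE E tS.
have K2 X : K (K X) = - X.
  have := congr1 (fun f : 'End(big W) => (f (t X)).1) J2.
  by rewrite comp_lfunE !JtE tS opp_lfunE id_lfunE /= tS.
split; first by split=> // X Y; rewrite -!JtE Jsk.
apply/vspaceP=> z; rewrite memv_cap mem_eigen_cext memv_cplxv.
apply/idP/(eigen_liftP _ _ K2) => [|[X ->]] /=.
  case: z => x y /= /andP[/andP[/eqP Jx _] /andP[/eigE[X xX] _]].
  by exists X; rewrite -JtE -xX Jx opprK.
rewrite opprK (linearN J) /= !JtE K2 (linearN t) /= opprK !eqxx /=.
by apply/andP; split; [|rewrite memvN]; apply/eigE; eexists.
Qed.

Lemma quadruple_frame (gamma : {dot W for idfun}) (psi : {skew_symmetric W}) :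
  let thetap X Y := psi X Y + gamma X Y in
  let thetam X Y := psi X Y - gamma X Y in
  [/\ bilinear_fun thetap, bilinear_fun thetam
    & metric_frame (tau_lift thetap) (tau_lift thetam)].
Proof.
move=> thetap thetam.
have gC X Y : gamma X Y = gamma Y X.
  by have := @hermitian_subproof _ _ _ _ gamma X Y; rewrite mul1r.
have pC X Y : psi X Y = - psi Y X.
  by have := @hermitian_subproof _ _ _ _ psi X Y; rewrite expr1 mulN1r.
have bp : bilinear_fun thetap.
  split=> Z a u v; rewrite /thetap.
    by rewrite !linearPr /= mulrDr addrACA.
  by rewrite !linearPl /= mulrDr addrACA.
have bm : bilinear_fun thetam.
  split=> Z a u v; rewrite /thetam.
    by rewrite !linearPr /= mulrBr opprD addrACA.
  by rewrite !linearPl /= mulrBr opprD addrACA.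
have half2 (a : R) : 2^-1 * (a + a) = a.
  by rewrite -mulr2n -[a *+ 2]mulr_natl mulrA mulVf ?mul1r // pnatr_eq0.
split=> //; split=> [X Y|X nzX|X nzX]; rewrite !tau_liftE // gpair_tau //.
- by rewrite /thetap /thetam (pC Y X) (gC Y X) -opprD subrr mulr0.
- have pp : psi X X = 0.
    have /eqP := pC X X; rewrite -addr_eq0 -mulr2n mulrn_eq0 /= => /eqP //.
  by rewrite half2 /thetap pp add0r; apply: neq0_dnorm_gt0.
have pp : psi X X = 0.
  have /eqP := pC X X; rewrite -addr_eq0 -mulr2n mulrn_eq0 /= => /eqP //.
by rewrite half2 /thetam pp add0r oppr_lt0; apply: neq0_dnorm_gt0.
Qed.

End Quadruple.

Theorem proposition4p2 (R : realType) (W : vectType R)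
    (G : {dot big W for idfun}) (H J : 'End(big W))
    (gamma : {dot W for idfun}) (psi : {skew_symmetric W}) (Jp Jm : 'End(W))
    (hGJ : generalized_hermitian G H J)
    (hquad : equivalent_quadruple H J gamma psi Jp Jm)
    (V : {vspace W}) :
  generalized_hermitian_subspace H J V <->
    (Jp @: V = V)%VS /\ (Jm @: V = V)%VS.
Proof.
have [bp bm frame] := quadruple_frame gamma psi.
set thetap := (fun X Y => psi X Y + gamma X Y) in bp frame.
set thetam := (fun X Y => psi X Y - gamma X Y) in bm frame.
set tp := tau_lift thetap in frame; set tm := tau_lift thetam in frame.
have [_ hJ JH] := hGJ; case: hquad => /= eigp eigm JpE JmE.
have tpS : lift_section tp by move=> X; rewrite /tp tau_liftE.
have tmS : lift_section tm by move=> X; rewrite /tm tau_liftE.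
have [hp LpE] : lift_hermitian tp Jp /\ Lplus H J = eigen_lift tp Jp.
  apply: (eigenspace_lift hJ JH tpS) => [x|X]; last by rewrite JpE tau_liftE.
  by rewrite eigp; split=> -[X ->]; exists X; rewrite tau_liftE.
have [hm LmE] : lift_hermitian tm Jm /\ Lminus H J = eigen_lift tm Jm.
  apply: (eigenspace_lift hJ JH tmS) => [x|X]; last by rewrite JmE tau_liftE.
  by rewrite eigm; split=> -[X ->]; exists X; rewrite tau_liftE.
have [p2 m2] := (lift_square hp, lift_square hm).
rewrite -(square_opp_stable V p2) -(square_opp_stable V m2).
rewrite /generalized_hermitian_subspace LpE LmE.
split=> [[full _ _ _]|[pV mV]].
  exact: (pullback_sum_full_stable frame tpS tmS p2 m2 full).
rewrite (congr2 (@defines_generalized_hermitian R (subvs_of V))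
           (pullback_eigen_lift pV tpS p2) (pullback_eigen_lift mV tmS m2)).
exact: (frame_defines_hermitian (restrict_frame V tpS tmS frame)
          (restrict_hermitian pV tpS hp) (restrict_hermitian mV tmS hm)).
Qed.
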